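(* Let $\Gamma$ be the path on $K$ vertices. Assume either that $\lambda>1$ and $K=o(\sqrt n)$, or that $\lambda<1$ and $K=\ln(n)/\ln(1/\lambda)-\omega(\ln(\ln(n)))$. Then the total variation distance between $\mathbb{P}_0$ and $\mathbb{P}_1$ tends to $0$ as $n\to\infty$. Consequently, for any test $T(G)\in\{0,1\}$, $\mathbb{P}_1(T(G)=1)-\mathbb{P}_0(T(G)=1)\to0$.
   Context: Model: $n$ nodes; $\lambda>0$ fixed. $\mathbb{P}_0$: $G\sim\mathcal G(n,\lambda/n)$. $\mathbb{P}_1$: $G=G_0\cup G'$ with $G_0\sim\mathcal G(n,\lambda/n)$ and $G'$ the image of the path $1-2-\cdots-K$ under a uniformly random injection $[K]\to[n]$ independent of $G_0$. *)

(* Defs.v *)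
From HB Require Import structures.
From mathcomp Require Import all_boot all_order all_algebra.
From mathcomp Require Import all_classical all_reals all_analysis.
Set Implicit Arguments. Unset Strict Implicit. Unset Printing Implicit Defensive.
Import Order.TTheory GRing.Theory Num.Theory.
Local Open Scope ring_scope.

(* A simple graph on vertex set 'I_n is encoded by its edge set: a set of
   ordered pairs (i, j) with i < j (one pair per unordered edge). *)
Definition graph (n : nat) := {set ('I_n * 'I_n)}.

Definition pairs (n : nat) : graph n := [set e : 'I_n * 'I_n | (e.1 < e.2)%N].

Definition uedge (n : nat) (i j : 'I_n) : 'I_n * 'I_n :=
  if (i < j)%N then (i, j) else (j, i).

(* Edge probability lambda/n of G(n, lambda/n) (capped at 1, which is
   irrelevant for n >= lambda). *)
Definition edgeprob (R : realType) (lam : R) (n : nat) : R :=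
  Num.min (lam / n%:R) 1.

Definition P0 (R : realType) (lam : R) (n : nat) (G : graph n) : R :=
  if G \subset pairs n then
    \prod_(e in pairs n)
       (if e \in G then edgeprob lam n else 1 - edgeprob lam n)
  else 0.

Definition injs (n K : nat) : {set {ffun 'I_K -> 'I_n}} :=
  [set f : {ffun 'I_K -> 'I_n} | injectiveb f].

Definition path_edges (n K : nat) (f : {ffun 'I_K -> 'I_n}) : graph n :=
  [set e : 'I_n * 'I_n | [exists i : 'I_K, exists j : 'I_K,
     ((j : nat) == i.+1) && (e == uedge (f i) (f j))]].

(* P_1(G) : law of G_0 \cup G' with G_0 ~ G(n, lambda/n) and G' the path
   image under a uniform injection independent of G_0. *)
Definition P1 (R : realType) (lam : R) (n K : nat) (G : graph n) : R :=
  (#|injs n K|%:R)^-1 *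
  \sum_(f in injs n K) \sum_(G0 : graph n)
      P0 lam G0 * ((G0 :|: path_edges f) == G)%:R.

Definition TV (R : realType) (lam : R) (n K : nat) : R :=
  2^-1 * \sum_(G : graph n) `|P0 lam G - P1 lam K G|.

Definition prob_test (R : realType) (n : nat) (P : graph n -> R)
  (T : graph n -> bool) : R :=
  \sum_(G : graph n) P G * (T G)%:R.

(* Main.v *)
(* Second moment method. With p the edge probability and E_f the edge set of the
   path placed by the injection f, the likelihood ratio is
   L(G) = avg_f 1{E_f <= G} p^-|E_f|, and its second moment under P_0 is
   avg_{f,g} p^-|E_f cap E_g|. For fixed f, reveal g one vertex at a time: each
   step enters the path f at a fresh vertex with probability at most
   q ~ K/n, and each further shared edge costs a factor rho ~ 1/lambda (twice
   that for the first one, which has two possible directions). Induction on the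
   number of steps left gives avg_g p^-|E_f cap E_g| <= (1 + q M)^K with
   M = 2 (1 + rho + ... + rho^K). This tends to 1 because K q M = O(K^2/n) when
   lambda > 1, and K q M = O(K^3 lambda^-K / n) = O(1 / ln n) when lambda < 1. *)

Require Import Defs.
From HB Require Import structures.
From mathcomp Require Import all_boot all_order all_algebra.
From mathcomp Require Import all_classical all_reals all_analysis.
From mathcomp Require Import zify ring lra.
Import Order.TTheory GRing.Theory Num.Theory.
Import numFieldNormedType.Exports.
Local Open Scope classical_set_scope.
Local Open Scope ring_scope.
Set Implicit Arguments. Unset Strict Implicit. Unset Printing Implicit Defensive.

(** * Random subsets with independent elements *)

Section RandomSubset.
Variables (R : realFieldType) (T : finType) (a : T -> R).

Definition subset_law (G : {set T}) : R :=
  \prod_e (if e \in G then a e else 1 - a e).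

(** Summing over [G] distributes a product of two-term sums, one per element: [e] in or out.
    Requiring [E \subset G] deletes the second term for [e] in [E], and elsewhere the two terms add
    up to 1. *)
Lemma sum_subset_law_superset (E : {set T}) :
  \sum_(G : {set T}) subset_law G * (E \subset G)%:R = \prod_(e in E) a e.
Proof.
transitivity (\prod_e (a e + (if e \in E then 0 else 1 - a e))); last first.
  rewrite [RHS]big_mkcond /=; apply: eq_bigr => e _.
  by case: ifP => _; rewrite ?addr0 // addrC subrK.
rewrite bigA_distr; apply: eq_bigr => G _.
have [sEG|/fintype.subsetPn[e eE eG]] := boolP (E \subset G); last first.
  by rewrite mulr0 (bigD1 e) //= (negbTE eG) eE mul0r.
rewrite mulr1; apply: eq_bigr => e _.
by case: ifPn => // eG; case: ifPn => // eE; rewrite (fintype.subsetP sEG) in eG.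
Qed.

Lemma sum_subset_law : \sum_(G : {set T}) subset_law G = 1.
Proof.
have := sum_subset_law_superset finset.set0; rewrite big_set0 => <-.
by apply: eq_bigr => G _; rewrite finset.sub0set mulr1.
Qed.

(** Planting [E] is a change of measure, computed element by element. For [e] in [E] both choices
    for [G0] lead to [e \in G], so the factor [a e] becomes 1, which is division by [a e]; outside
    [E] the factor is unchanged. *)
Lemma subset_law_setU (E G : {set T}) : (forall e, e \in E -> a e != 0) ->
  \sum_(G0 : {set T}) subset_law G0 * ((G0 :|: E)%SET == G)%:R =
  subset_law G * ((E \subset G)%:R * \prod_(e in E) (a e)^-1).
Proof.
move=> a_neq0.
transitivity (\prod_e (a e * (e \in G)%:R +
                       (1 - a e) * ((e \in E) == (e \in G))%:R)).
  rewrite bigA_distr; apply: eq_bigr => G0 _.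
  have [<-|/eqP neG] := eqVneq (G0 :|: E)%SET G.
    rewrite mulr1; apply: eq_bigr => e _; rewrite finset.in_setU.
    by case: ifP => _ /=; rewrite ?eqxx ?mulr1.
  rewrite mulr0; suff [e ne] : exists e, (e \in (G0 :|: E)%SET) != (e \in G).
    rewrite (bigD1 e) //=; move: ne; rewrite finset.in_setU.
    by case: (e \in G0); case: (e \in E); case: (e \in G) => //= _;
      rewrite mulr0 mul0r.
  apply/existsP; apply: contra_notT neG; rewrite negb_exists => /forallP h.
  by apply/setP => e; apply/eqP; rewrite -[_ == _]negbK h.
have [sEG|/fintype.subsetPn[e eE eG]] := boolP (E \subset G); last first.
  by rewrite mul0r mulr0 (bigD1 e) //= eE (negbTE eG) !mulr0 addr0 mul0r.
rewrite mul1r [in RHS]big_mkcond /= -big_split /=; apply: eq_bigr => e _.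
have [eE|eE] := boolP (e \in E).
  by rewrite (fintype.subsetP sEG) // eqxx !mulr1 divff ?a_neq0 // addrC subrK.
by case: (e \in G); rewrite /= ?mulr0 ?mulr1 ?addr0 ?add0r.
Qed.

End RandomSubset.

(** * The likelihood ratio and its second moment *)

Section LikelihoodRatio.
Variables (R : realType) (lam : R) (n K : nat).
Hypotheses (lam_gt0 : 0 < lam) (le_Kn : (K <= n)%N) (n_gt0 : (0 < n)%N).
Local Notation p := (edgeprob lam n).
Local Notation inj := (injs n K).

Let p_gt0 : 0 < p.
Proof. by rewrite /edgeprob lt_min ltr01 andbT divr_gt0 // ltr0n. Qed.

Let p_le1 : p <= 1.
Proof. by rewrite /edgeprob ge_min lexx orbT. Qed.

(** Giving probability 0 to the pairs outside [pairs n] absorbs the support condition of [P0] into a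
    product over all ordered pairs. *)
Let edge_law (e : 'I_n * 'I_n) : R := if e \in pairs n then p else 0.

Lemma P0_subset_law (G : graph n) : P0 lam G = subset_law edge_law G.
Proof.
rewrite /P0 /subset_law /edge_law.
have [sG|/fintype.subsetPn[e eG eP]] := boolP (G \subset pairs n); last first.
  by rewrite (bigD1 e) //= eG (negbTE eP) mul0r.
rewrite big_mkcond; apply: eq_bigr => e _.
have [eP|eP] := boolP (e \in pairs n) => //.
by rewrite (negbTE (contra (fintype.subsetP sG e) eP)) subr0.
Qed.

Lemma P0_ge0 (G : graph n) : 0 <= P0 lam G.
Proof.
rewrite /P0; case: ifP => // _; apply: prodr_ge0 => e _.
by case: ifP => _; [exact: ltW | rewrite subr_ge0].
Qed.

Lemma path_edges_pairs (f : {ffun 'I_K -> 'I_n}) :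
  f \in inj -> path_edges f \subset pairs n.
Proof.
rewrite inE => /injectiveP f_inj; apply/fintype.subsetP => e.
rewrite !inE => /existsP[i /existsP[j /andP[/eqP ji /eqP ->]]].
have fij : f i != f j.
  by apply/eqP => /f_inj /(congr1 val) /=; rewrite ji => /eqP; rewrite ltn_eqF.
rewrite /uedge; case: ifPn => //= /negbTE hf.
by rewrite ltn_neqAle leqNgt hf eq_sym fij.
Qed.

Definition likelihood (G : graph n) : R :=
  (#|inj|%:R)^-1 *
  \sum_(f in inj) (path_edges f \subset G)%:R * p^-1 ^+ #|path_edges f|.

Let edge_law_prod (E : graph n) (F : R -> R) : E \subset pairs n ->
  \prod_(e in E) F (edge_law e) = F p ^+ #|E|.
Proof.
move=> sE; rewrite -prodr_const; apply: eq_bigr => e eE.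
by rewrite /edge_law (fintype.subsetP sE).
Qed.

Lemma P1_likelihood (G : graph n) : P1 lam K G = P0 lam G * likelihood G.
Proof.
rewrite /P1 /likelihood mulrCA; congr (_ * _); rewrite big_distrr /=.
apply: eq_bigr => f fI.
under eq_bigr do rewrite P0_subset_law.
rewrite subset_law_setU ?P0_subset_law.
  by rewrite (edge_law_prod GRing.inv) // path_edges_pairs.
move=> e /(fintype.subsetP (path_edges_pairs fI)) eP.
by rewrite /edge_law eP gt_eqF.
Qed.

Let injs_gt0 : 0 < (#|inj|%:R : R).
Proof. by rewrite ltr0n /injs card_inj_ffuns !card_ord ffact_gt0. Qed.

Let sumP0_superset (E : graph n) : E \subset pairs n ->
  \sum_(G : graph n) P0 lam G * (E \subset G)%:R = p ^+ #|E|.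
Proof.
move=> sE; rewrite -(edge_law_prod id) // -sum_subset_law_superset.
by apply: eq_bigr => G _; rewrite P0_subset_law.
Qed.

Lemma sum_P0 : \sum_(G : graph n) P0 lam G = 1.
Proof.
rewrite -(sum_subset_law edge_law).
by apply: eq_bigr => G _; rewrite P0_subset_law.
Qed.

Lemma sum_P0_likelihood : \sum_(G : graph n) P0 lam G * likelihood G = 1.
Proof.
under eq_bigr do rewrite mulrCA big_distrr /=.
rewrite -big_distrr /= exchange_big /= (eq_bigr (fun=> 1)); last first.
  move=> f fI; under eq_bigr do rewrite mulrA.
  rewrite -big_distrl /= sumP0_superset ?path_edges_pairs //.
  by rewrite -exprMn divff ?gt_eqF // expr1n.
by rewrite sumr_const mulVf // gt_eqF.
Qed.

(** Expanding the square gives a double average over [f] and [g]. Both paths lie in [G] with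
    probability [p] to the size of the union of their edge sets; dividing by [p] to the sum of the
    two sizes leaves the intersection. *)
Lemma sum_P0_likelihood_sqr :
  \sum_(G : graph n) P0 lam G * likelihood G ^+ 2 =
  (#|inj|%:R)^-1 * \sum_(f in inj) ((#|inj|%:R)^-1 *
     \sum_(g in inj) p^-1 ^+ #|(path_edges f :&: path_edges g)%SET|).
Proof.
have likelihood_sqr G : likelihood G ^+ 2 = #|inj|%:R^-1 ^+ 2 *
    \sum_(f in inj) \sum_(g in inj)
      (path_edges f \subset G)%:R * p^-1 ^+ #|path_edges f| *
      ((path_edges g \subset G)%:R * p^-1 ^+ #|path_edges g|).
  by rewrite /likelihood exprMn; congr (_ * _); rewrite expr2 big_distrlr.
under eq_bigr do rewrite likelihood_sqr mulrCA.
rewrite -big_distrr -[in RHS]big_distrr /= mulrA -expr2.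
congr (_ * _); under eq_bigr do rewrite big_distrr /=.
rewrite exchange_big /=; apply: eq_bigr => f fI.
under eq_bigr do rewrite big_distrr /=.
rewrite exchange_big /=; apply: eq_bigr => g gI.
transitivity ((\sum_(G : graph n) P0 lam G *
     ((path_edges f :|: path_edges g)%SET \subset G)%:R) /
     (p ^+ #|path_edges f| * p ^+ #|path_edges g|)).
  rewrite big_distrl /=; apply: eq_bigr => G _.
  by rewrite finset.subUset -mulnb natrM invfM !exprVn; ring.
rewrite sumP0_superset; last by rewrite finset.subUset !path_edges_pairs.
rewrite -exprD -cardsUI exprD invfM mulrA divff ?mul1r ?exprVn //.
by rewrite expf_neq0 // gt_eqF.
Qed.

(* Second moment method: [|1 - L| <= (eps + (1 - L)^2 / eps) / 2]. *)
Lemma sum_dist_le (B eps : R) : 0 < eps ->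
  (forall f, f \in inj ->
    \sum_(g in inj) p^-1 ^+ #|(path_edges f :&: path_edges g)%SET|
      <= #|inj|%:R * B) ->
  B <= 1 + eps ^+ 2 ->
  \sum_(G : graph n) `|P0 lam G - P1 lam K G| <= eps.
Proof.
move=> eps_gt0 hB leB.
have sq : \sum_(G : graph n) P0 lam G * likelihood G ^+ 2 <= B.
  rewrite sum_P0_likelihood_sqr ler_pdivrMl //.
  apply: (@le_trans _ _ (\sum_(f in inj) B)).
    by apply: ler_sum => f fI; rewrite ler_pdivrMl // hB.
  by rewrite sumr_const mulr_natl.
apply: (@le_trans _ _ (\sum_(G : graph n)
   (2^-1 * eps * P0 lam G + 2^-1 / eps * (P0 lam G - 2 * (P0 lam G * likelihood G)
      + P0 lam G * likelihood G ^+ 2)))).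
  apply: ler_sum => G _; rewrite P1_likelihood.
  have := P0_ge0 G; move: (P0 lam G) (likelihood G) => x L x_ge0.
  have -> : x - x * L = x * (1 - L) by ring.
  rewrite normrM (ger0_norm x_ge0) -subr_ge0.
  have -> : 2^-1 * eps * x + 2^-1 / eps * (x - 2 * (x * L) + x * L ^+ 2)
      - x * `|1 - L| = x * (eps^-1 / 2 * (eps - `|1 - L|) ^+ 2).
    have -> : x - 2 * (x * L) + x * L ^+ 2 = x * (`|1 - L| ^+ 2).
      by rewrite real_normK ?num_real //; ring.
    by field; rewrite gt_eqF.
  by rewrite mulr_ge0 // mulr_ge0 ?sqr_ge0 // divr_ge0 // invr_ge0 ltW.
(* As [P0] and [P0 * L] both have total mass 1, the sum is [eps / 2 + (S - 1) / (2 * eps)], where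
   [S] is the second moment. *)
rewrite big_split -!big_distrr /= big_split sumrB /= -big_distrr /=.
rewrite sum_P0 sum_P0_likelihood.
move: sq; set S := \sum_i _ => sq.
have {}leB : S - 1 <= eps ^+ 2 by rewrite lerBlDl (le_trans sq).
have : 2^-1 / eps * (S - 1) <= 2^-1 * eps.
  by rewrite -mulrA ler_pM2l // ler_pdivrMl // -expr2.
by lra.
Qed.

End LikelihoodRatio.

(** * Unordered edges, and sums over tuples *)

Lemma uedgeC n (u v : 'I_n) : uedge u v = uedge v u.
Proof.
by rewrite /uedge; case: ltngtP => // /val_inj ->.
Qed.

Lemma uedge_inj n (a b u v : 'I_n) :
  uedge a b = uedge u v -> (a = u /\ b = v) \/ (a = v /\ b = u).
Proof.
by rewrite /uedge; case: ifP => _; case: ifP => _ [-> ->]; [left|right|right|left].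
Qed.

Lemma sum_tuple_cons (V : nmodType) (T : finType) n (F : n.+1.-tuple T -> V) :
  \sum_t F t = \sum_x \sum_(t : n.-tuple T) F (cons_tuple x t).
Proof.
rewrite pair_bigA /= (reindex (fun xt : T * n.-tuple T => cons_tuple xt.1 xt.2)) //=.
exists (fun t => (thead t, behead_tuple t)) => [[x t] _|t _] /=.
  by rewrite theadE; congr (_, _); apply: val_inj.
by rewrite [RHS]tuple_eta; apply: val_inj.
Qed.

(** In tuple form the vertices of a path can be summed out one at a time, starting from the head. *)
Lemma sum_ffun_tuple (V : nmodType) (T : finType) K (P : pred {ffun 'I_K -> T})
    (F : {ffun 'I_K -> T} -> V) :
  \sum_(g | P g) F g =
  \sum_(t : K.-tuple T | P (finfun (tnth t))) F (finfun (tnth t)).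
Proof.
rewrite (reindex (fun t : K.-tuple T => finfun (tnth t))) //=.
exists (fun g : {ffun 'I_K -> T} => [tuple g i | i < K]) => [t _|g _].
  by apply: eq_from_tnth => i; rewrite tnth_mktuple ffunE.
by apply/ffunP => i; rewrite ffunE tnth_mktuple.
Qed.

(** * Neighbours on a fixed path, and edges shared with a second one *)

Section PathNeighbours.
Variables (n K : nat) (f : {ffun 'I_K -> 'I_n}).
Hypothesis f_inj : injective f.
Local Notation E := (path_edges f).

Definition nbr (v u : 'I_n) : bool := uedge v u \in E.

Lemma nbrC v u : nbr v u = nbr u v.
Proof. by rewrite /nbr uedgeC. Qed.

Lemma nbr_index v u : nbr v u -> exists i j : 'I_K,
  [/\ v = f i, u = f j & (j == i.+1 :> nat) || (i == j.+1 :> nat)].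
Proof.
rewrite /nbr inE => /existsP[i /existsP[j /andP[ij /eqP]]].
case/uedge_inj => -[-> ->]; first by exists i, j; rewrite ij.
by exists j, i; rewrite ij orbT.
Qed.

Lemma nbr_codom v u : nbr v u -> v \in codom f.
Proof. by case/nbr_index => i [j [-> _ _]]; rewrite codom_f. Qed.

Definition nbrs (v : 'I_n) : {set 'I_n} := finset (nbr v).

(** By injectivity a vertex of the path has a single index [i]; its neighbours have index [i + 1]
    (the set [A]) or [i - 1] (the set [B]). *)
Lemma card_nbrs v : (#|nbrs v| <= 2)%N.
Proof.
have [/codomP[i ->]|vNf] := boolP (v \in codom f); last first.
  rewrite (_ : nbrs v = finset.set0) ?cards0 //; apply/setP => u.
  by rewrite !inE; apply: contraNF vNf; exact: nbr_codom.
pose A := finset (fun j : 'I_K => j == i.+1 :> nat).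
pose B := finset (fun j : 'I_K => i == j.+1 :> nat).
have card_A : (#|A| <= 1)%N.
  apply/card_le1_eqP => j k; rewrite !inE => /eqP ji /eqP ki.
  by apply: val_inj; rewrite /= ji ki.
have card_B : (#|B| <= 1)%N.
  apply/card_le1_eqP => j k; rewrite !inE => /eqP ji /eqP ki.
  by apply: val_inj; apply: succn_inj; rewrite -ji -ki.
have /subset_leq_card : nbrs (f i) \subset f @: (A :|: B)%SET.
  apply/fintype.subsetP => u; rewrite inE => /nbr_index[i' [j [/f_inj <- -> ij]]].
  by apply: imset_f; rewrite !inE.
move/leq_trans; apply; apply: leq_trans (leq_imset_card _ _) _.
by rewrite cardsU (leq_trans (leq_subr _ _)) // (leq_add card_A card_B).
Qed.

(** Counting along the walk, with multiplicity, makes the weight [y ^+ shared_edges v s] factor over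
    the steps. It dominates the number of distinct shared edges, which suffices for an upper bound
    when [y >= 1]. *)
Definition shared_edges (v : 'I_n) (s : seq 'I_n) : nat :=
  count (mem E) (pairmap (@uedge n) v s).

Lemma card_shared_edges v0 (t : K.-tuple 'I_n) :
  (#|(E :&: path_edges (finfun (tnth t)))%SET|
    <= shared_edges (head v0 t) (behead t))%N.
Proof.
rewrite /shared_edges -size_filter.
apply: leq_trans (card_size _); apply: subset_leq_card.
apply/fintype.subsetP => x; rewrite finset.in_setI => /andP[xE].
rewrite mem_filter /= xE /= inE => /existsP[i /existsP[j /andP[/eqP ji /eqP ->]]].
rewrite !ffunE !(tnth_nth v0).
have it : (i < size (behead t))%N.
  by rewrite size_behead size_tuple ltn_predRL -ji.
apply/(nthP (v0, v0)); exists i; first by rewrite size_pairmap.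
rewrite (nth_pairmap v0) // nth_behead ji; congr (uedge _ _).
by case: (val t) it.
Qed.

(** * Weighted count of the self-avoiding continuations of a walk *)

Section WeightedExtensions.
Variables (R : realType) (y q rho : R).
Hypotheses (y_ge1 : 1 <= y) (q_ge0 : 0 <= q) (rho_ge0 : 0 <= rho).
Hypothesis lt_Kn : (K < n)%N.
(** While at most [K] vertices are used, a fresh one has at least [n - K] possible values. So [q]
    bounds the chance of landing on the path [f], and [rho] the chance of hitting one prescribed
    neighbour times the weight [y] of the edge so shared. *)
Hypotheses (le_q : K%:R <= q * (n - K)%:R) (le_rho : y <= rho * (n - K)%:R).

(** Partition function of the injective continuations by [j] vertices: [s] holds the used vertices
    and [v] is the current endpoint. *)
Fixpoint ext_weight j (s : seq 'I_n) v : R :=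
  if j is j'.+1
  then \sum_(u | u \notin s) y ^+ nbr v u * ext_weight j' (u :: s) u
  else 1.

Lemma ext_weightE j s v : ext_weight j s v =
  \sum_(t : j.-tuple 'I_n | uniq t && ~~ has (mem s) t) y ^+ shared_edges v t.
Proof.
elim: j s v => [|j IH] s v /=.
  by rewrite (big_pred1 [tuple]) // => t; rewrite [t]tuple0 /= eqxx.
rewrite big_mkcond [RHS]big_mkcond sum_tuple_cons; apply: eq_bigr => u _ /=.
have [us|us] := boolP (u \in s); rewrite /= ?andbF ?andbT.
  by rewrite big1 // => t _; rewrite andbF.
rewrite IH big_distrr big_mkcond /=; apply: eq_bigr => t _.
have -> : has (mem (u :: s)) t = (u \in (t : seq _)) || has (mem s) t.
  rewrite -has_pred1 -has_predU; apply: eq_has => x /=.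
  by rewrite inE eq_sym.
rewrite negb_or andbCA andbA; case: ifP => // _.
by rewrite /shared_edges /= -exprD.
Qed.

Definition geom_sum j : R := \sum_(i < j.+1) rho ^+ i.
Local Notation M := (2 * geom_sum K).
Local Notation gam := (1 + q * M).

Lemma geom_sumS j : geom_sum j.+1 = 1 + rho * geom_sum j.
Proof.
rewrite /geom_sum big_ord_recl expr0 big_distrr /=; congr (_ + _).
by apply: eq_bigr => i _; rewrite exprS.
Qed.

Lemma geom_sum_ge1 j : 1 <= geom_sum j.
Proof.
by rewrite /geom_sum big_ord_recl expr0 lerDl sumr_ge0 // => i _; rewrite exprn_ge0.
Qed.

Lemma geom_sum_le i j : (i <= j)%N -> geom_sum i <= geom_sum j.
Proof.
move=> /subnK <-; elim: (j - i)%N => [|k IH]; first by rewrite add0n.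
rewrite addSn (le_trans IH) // /geom_sum [leRHS]big_ord_recr lerDl /=.
exact: exprn_ge0.
Qed.

(* A vertex with a neighbour on the path [f] among the revealed vertices [s]
   can be continued along that path in one direction only, hence the missing
   factor 2. *)
Definition ext_bound j (s : seq 'I_n) v : R :=
  if v \notin codom f then 1
  else if has (nbr v) s then geom_sum j else 2 * geom_sum j.

Let gam_ge1 : 1 <= gam.
Proof.
rewrite lerDl mulr_ge0 // mulr_ge0 // (le_trans ler01) //; exact: geom_sum_ge1.
Qed.

Lemma ext_bound_le j s v : (j <= K)%N -> ext_bound j s v <= 1 + (v \in codom f)%:R * M.
Proof.
move=> jK; have := geom_sum_le jK; have := geom_sum_ge1 j; rewrite /ext_bound.
by case: (v \in codom f); rewrite /= ?mul1r ?mul0r ?addr0 //; case: ifP => _; lra.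
Qed.

Lemma card_codom_le : (\sum_(u : 'I_n) (u \in codom f)%:R : R) <= K%:R.
Proof.
rewrite -natr_sum -big_mkcond /= sum1_card ler_nat.
by rewrite (leq_trans (card_size _)) // size_codom card_ord.
Qed.

(** Induction on [j] by revealing the next vertex [u]. Landing on the path costs at most an extra
    [M], averaged into the factor [gam]. Following an edge of the path from [v] is paid by
    [ext_bound], through the recursion [geom_sumS]. *)
Lemma ext_weight_le j s v : uniq s -> v \in s -> (size s + j <= K)%N ->
  ext_weight j s v <= ((n - size s) ^_ j)%:R * gam ^+ j * ext_bound j s v.
Proof.
elim: j s v => [|j IH] s v us vs szs.
  rewrite /= ffactn0 expr0 !mul1r /ext_bound; have := geom_sum_ge1 0.
  by case: ifP => // _; case: ifP => // _; lra.
have jK : (j <= K)%N by lia.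
set S := (n - size s)%N; set D : R := ((S.-1) ^_ j)%:R * gam ^+ j.
have D_ge0 : 0 <= D by rewrite mulr_ge0 // exprn_ge0 // (le_trans ler01).
have c_ge0 : 0 <= geom_sum j by rewrite (le_trans ler01) // geom_sum_ge1.
have M_ge0 : 0 <= M by rewrite mulr_ge0 // (le_trans ler01) // geom_sum_ge1.
have y_ge0 : 0 <= y by rewrite (le_trans ler01).
have S_ge : (n - K)%:R <= S%:R :> R by rewrite ler_nat; lia.
(* [N] is the number of path edges at [v] that the walk can still follow. *)
set N := #|(nbrs v :\: [set:: s])%SET|.
have step u : u \notin s -> y ^+ nbr v u * ext_weight j (u :: s) u <=
    D * (1 + (u \in codom f)%:R * M + (nbr v u)%:R * (y * geom_sum j)).
  move=> uNs; have := IH (u :: s) u; rewrite /= uNs us inE eqxx /= addSnnS.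
  move=> /(_ isT isT szs); rewrite subnS -/S -/D => IHu.
  apply: (@le_trans _ _ (y ^+ nbr v u * (D * ext_bound j (u :: s) u))).
    by rewrite ler_wpM2l // exprn_ge0.
  rewrite mulrCA ler_wpM2l //.
  (* If [u] is a neighbour of [v], then [v] is a used neighbour of [u]: only one direction remains,
     and the bound at [u] has no factor 2. *)
  have [vu|vu] := boolP (nbr v u); last first.
    by rewrite expr0 mul1r mul0r addr0 ext_bound_le.
  have uV : u \in codom f by rewrite (@nbr_codom _ v) // nbrC.
  have -> : ext_bound j (u :: s) u = geom_sum j.
    rewrite /ext_bound uV /= ifT //; apply/orP; right.
    by apply/hasP; exists v; rewrite // nbrC.
  by rewrite uV expr1 !mul1r lerDr addr_ge0.
have sumS : \sum_(u | u \notin s) (1 : R) = S%:R.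
  rewrite sumr_const; congr (_%:R).
  have := cardC (mem s); rewrite card_ord (card_uniqP us) => cardC_s.
  suff <- : #|[predC mem s]| = S by apply: eq_card.
  by apply: (@addnI (size s)); rewrite cardC_s subnKC //; lia.
have sumV : \sum_(u | u \notin s) (u \in codom f)%:R * M <= K%:R * M.
  rewrite -big_distrl ler_wpM2r //= (le_trans _ card_codom_le) //.
  by rewrite big_mkcond ler_sum // => u _; case: ifP.
have sumN : \sum_(u | u \notin s) (nbr v u)%:R * (y * geom_sum j) =
    N%:R * (y * geom_sum j).
  rewrite -big_distrl /=; congr (_ * _); rewrite -natr_sum /N -sum1_card; congr (_%:R).
  rewrite big_mkcond [RHS]big_mkcond; apply: eq_bigr => u _.
  by rewrite !inE; case: (u \in s) => //=; case: (nbr v u).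
(* The three cases of [ext_bound]: [N] is 0 off the path, at most 1 if some neighbour of [v] is
   used, and at most 2 otherwise. *)
have N_le : 1 + N%:R * (rho * geom_sum j) <= ext_bound j.+1 s v.
  have rc_ge0 : 0 <= rho * geom_sum j by rewrite mulr_ge0.
  have N2 : (N <= 2)%N.
    by rewrite (leq_trans _ (card_nbrs v)) // subset_leq_card // finset.subsetDl.
  have N2R : N%:R <= 2 :> R by rewrite ler_nat.
  rewrite /ext_bound geom_sumS; case: ifPn => [vV|_].
    suff -> : N = 0%N by rewrite mul0r addr0.
    apply/eqP; rewrite cards_eq0 -finset.subset0; apply/fintype.subsetP => u.
    by rewrite !inE => /andP[_ /nbr_codom]; rewrite (negbTE vV).
  case: ifPn => [/hasP[w ws vw]|_]; last by nra.
  have : (N < 2)%N.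
    apply: leq_trans (card_nbrs v); rewrite (cardsD1 w (nbrs v)) inE vw add1n ltnS.
    apply: subset_leq_card; apply/fintype.subsetP => u; rewrite !inE.
    by case/andP => uNs ->; rewrite andbT; apply: contraNneq uNs => ->.
  rewrite ltnS -(ler_nat R) => N1; nra.
rewrite /= (le_trans (ler_sum _ step)) // -big_distrr /= !big_split /=.
rewrite sumS sumN ffactnS natrM exprS.
have -> : S%:R * (S.-1 ^_ j)%:R * (gam * gam ^+ j) * ext_bound j.+1 s v
  = D * (S%:R * gam * ext_bound j.+1 s v) by rewrite /D; ring.
rewrite ler_wpM2l //.
have S_ge0 : 0 <= S%:R :> R by [].
have leK : K%:R * M <= S%:R * (q * M).
  rewrite [leRHS](_ : _ = q * S%:R * M); last by ring.
  by rewrite ler_wpM2r // (le_trans le_q) // ler_wpM2l.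
have ley : N%:R * (y * geom_sum j) <= S%:R * (N%:R * (rho * geom_sum j)).
  rewrite [leRHS]mulrCA ler_wpM2l // mulrA ler_wpM2r //.
  by rewrite mulrC (le_trans le_rho) // ler_wpM2l.
(* The first two sums give at most [S + K * M <= S * gam]; the third gives at most
   [S * N * rho * geom_sum j], which may be multiplied by [gam >= 1]. *)
apply: (@le_trans _ _ (S%:R * gam * (1 + N%:R * (rho * geom_sum j)))); last first.
  by rewrite ler_wpM2l // mulr_ge0 // (le_trans ler01).
have : S%:R * (N%:R * (rho * geom_sum j)) <= S%:R * (N%:R * (rho * geom_sum j)) * gam.
  by rewrite ler_peMr // !mulr_ge0.
move: sumV leK ley; set x := N%:R * (rho * _); set z := N%:R * _.
set A := \sum_(u | _) _ * M; move: (q * M) => qM.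
set KM := K%:R * _; nra.
Qed.

Lemma sum_injs_le :
  \sum_(g in injs n K) y ^+ #|(E :&: path_edges g)%SET| <=
  (#|injs n K|%:R : R) * gam ^+ K.
Proof.
have v0 : 'I_n := Ordinal (leq_trans (ltn0Sn K) lt_Kn).
have M_ge0 : 0 <= M by rewrite mulr_ge0 // (le_trans ler01) // geom_sum_ge1.
have tuples m : (m <= K)%N ->
    \sum_(t : m.-tuple 'I_n | uniq t) y ^+ shared_edges (head v0 t) (behead t)
    <= (n ^_ m)%:R * gam ^+ m.
  case: m => [_|m mK].
    by rewrite (big_pred1 [tuple]) ?mulr1 // => t; rewrite [t]tuple0 /= eqxx.
  rewrite big_mkcond sum_tuple_cons /=.
  apply: (@le_trans _ _ (\sum_u ((n.-1 ^_ m)%:R * gam ^+ m *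
                          (1 + (u \in codom f)%:R * M)))).
    apply: ler_sum => u _; rewrite -big_mkcond /=.
    have -> : \sum_(t : m.-tuple 'I_n | (u \notin (t : seq _)) && uniq t)
        y ^+ shared_edges u t = ext_weight m [:: u] u.
      rewrite ext_weightE; apply: eq_bigl => t; rewrite andbC; congr (_ && ~~ _).
      by rewrite -has_pred1; apply: eq_has => x /=; rewrite inE.
    apply: le_trans (ext_weight_le _ _ _) _ => //; first by rewrite inE.
    rewrite subn1 ler_wpM2l ?ext_bound_le ?(ltnW mK) //.
    by rewrite mulr_ge0 // exprn_ge0 // (le_trans ler01).
  (* The first vertex closes no edge: its [n] choices, at most [K] of them on the path, contribute
     at most [n + K * M <= n * gam]. *)
  rewrite -big_distrr big_split /= -big_distrl sumr_const card_ord ffactnS natrM exprS.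
  rewrite [leRHS](_ : _ = (n.-1 ^_ m)%:R * gam ^+ m * (n%:R * gam)); last by ring.
  apply: ler_wpM2l; first by rewrite mulr_ge0 // exprn_ge0 // (le_trans ler01).
  rewrite mulrDr mulr1 lerD2l mulrA ler_wpM2r // (le_trans card_codom_le) //.
  rewrite (le_trans le_q) // mulrC ler_wpM2r // ler_nat; exact: leq_subr.
rewrite {2}/injs card_inj_ffuns !card_ord (le_trans _ (tuples K _)) //.
rewrite sum_ffun_tuple /= [leRHS]big_mkcond /= big_mkcond /=.
apply: ler_sum => t _; rewrite inE.
have -> : injectiveb (finfun (tnth t)) = uniq t.
  apply/injectiveP/tuple_uniqP => inj i j e; apply: inj; move: e; rewrite !ffunE //.
by case: ifP => // _; rewrite ler_weXn2l // card_shared_edges.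
Qed.

End WeightedExtensions.
End PathNeighbours.

(** * Choice of parameters in the two regimes *)

Section Asymptotics.
Variables (R : realType) (lam : R).
Hypothesis lam_gt0 : 0 < lam.

(** The second moment bound is a [K]-th power of [1 + x]; [1 + x <= expR x] reduces the requirement
    that it be at most [1 + eps ^+ 2] to a linear condition on the exponent. *)
Lemma sum_dist_small n K (eps q rho C : R) :
  0 < eps -> lam <= n%:R -> (K < n)%N -> 0 <= q -> 0 <= rho ->
  K%:R <= q * (n - K)%:R -> n%:R / lam <= rho * (n - K)%:R ->
  geom_sum rho K <= C -> K%:R * (q * (2 * C)) <= ln (1 + eps ^+ 2) ->
  \sum_(G : graph n) `|P0 lam G - P1 lam K G| <= eps.
Proof.
move=> eps_gt0 le_lam lt_Kn q_ge0 rho_ge0 le_q le_rho le_C le_ln.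
have n_gt0 : (0 < n)%N by exact: leq_trans lt_Kn.
have n_gt0R : 0 < n%:R :> R by rewrite ltr0n.
have pE : (edgeprob lam n)^-1 = n%:R / lam.
  by rewrite /edgeprob min_l ?invf_div // ler_pdivrMr // mul1r.
have G_ge0 : 0 <= geom_sum rho K by rewrite (le_trans ler01) // geom_sum_ge1.
apply: (@sum_dist_le _ _ _ _ _ (ltnW lt_Kn) _
  ((1 + q * (2 * geom_sum rho K)) ^+ K)) => //.
  move=> f; rewrite inE => /injectiveP f_inj; apply: sum_injs_le => //.
    by rewrite pE ler_pdivlMr // mul1r.
  by rewrite pE.
have eps2_gt0 : 0 < eps ^+ 2 by rewrite exprn_gt0.
rewrite -[leRHS]lnK; last by rewrite posrE addr_gt0.
apply: (@le_trans _ _ (expR (q * (2 * geom_sum rho K)) ^+ K)).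
  by rewrite lerXn2r ?nnegrE ?expR_ge1Dx ?expR_ge0 ?addr_ge0 ?mulr_ge0.
rewrite -expRM_natl ler_expR (le_trans _ le_ln) // !ler_wpM2l //.
Qed.

Lemma geom_sum_lt1 (rho : R) K : 0 <= rho -> rho < 1 ->
  geom_sum rho K <= (1 - rho)^-1.
Proof.
move=> rho_ge0 rho_lt1; have rho'_gt0 : 0 < 1 - rho by rewrite subr_gt0.
elim: K => [|K IH].
  by rewrite /geom_sum big_ord1 invf_ge1 // lerBlDr lerDl.
rewrite geom_sumS [leRHS](_ : _ = 1 + rho / (1 - rho)); last first.
  by field; rewrite gt_eqF.
by rewrite lerD2l ler_wpM2l.
Qed.

Lemma geom_sum_ge1_le (rho : R) K : 1 <= rho ->
  geom_sum rho K <= K.+1%:R * rho ^+ K.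
Proof.
move=> rho_ge1; rewrite /geom_sum mulr_natl -[X in _ *+ X]card_ord -sumr_const.
by apply: ler_sum => i _; rewrite ler_weXn2l // -ltnS.
Qed.

Lemma sum_dist_supercritical (K : nat -> nat) (eps : R) :
  1 < lam -> (fun n : nat => (K n)%:R / Num.sqrt (n%:R : R)) @ \oo --> (0 : R) ->
  0 < eps ->
  \forall n \near \oo, \sum_(G : graph n) `|P0 lam G - P1 lam (K n) G| <= eps.
Proof.
move=> lam_gt1 K_small eps_gt0.
set d := ln (1 + eps ^+ 2).
have d_gt0 : 0 < d by rewrite ln_gt0 // ltrDl exprn_gt0.
(* This lies strictly between [1 / lam] and 1, which leaves room for the factor [n / (n - K)] and
   keeps the geometric sum bounded. *)
pose rho : R := 2 / (1 + lam).
have rho_gt0 : 0 < rho by rewrite divr_gt0 // addr_gt0.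
have rho_lt1 : rho < 1 by rewrite ltr_pdivrMr ?addr_gt0 // mul1r; lra.
pose C := (1 - rho)^-1; have C_gt0 : 0 < C by rewrite invr_gt0 subr_gt0.
(* With [K <= eta * sqrt n], the first entry gives [2 * K * lam <= n * (lam - 1)], which is the
   condition on [rho]; the second gives [4 * C * K ^ 2 / n <= d]. *)
pose eta := Num.min ((lam - 1) / (2 * lam)) (d / (4 * C)).
have eta_gt0 : 0 < eta.
  by rewrite lt_min !divr_gt0 ?mulr_gt0 ?subr_gt0.
have eta_le1 : eta <= (lam - 1) / (2 * lam) by rewrite ge_min lexx.
have eta_le2 : eta <= d / (4 * C) by rewrite ge_min lexx orbT.
have eta_half : eta * (2 * lam) <= lam - 1.
  by rewrite -ler_pdivlMr // mulr_gt0.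
have eta_d : eta * (4 * C) <= d by rewrite -ler_pdivlMr // mulr_gt0.
have /cvgr0Pnorm_le/(_ eta eta_gt0) K_near := K_small.
near=> n.
have n_ge : lam <= n%:R by near: n; exact: nbhs_infty_ger.
have n_gt0 : 0 < n%:R :> R by exact: lt_le_trans n_ge.
have sn_gt0 : 0 < Num.sqrt (n%:R : R) by rewrite sqrtr_gt0.
have Ks : (K n)%:R <= eta * Num.sqrt (n%:R : R).
  rewrite -ler_pdivrMr //.
  have : `|(K n)%:R / Num.sqrt (n%:R : R)| <= eta by near: n.
  exact: le_trans (ler_norm _).
have sn_sq : Num.sqrt (n%:R : R) ^+ 2 = n%:R by rewrite sqr_sqrtr // ltW.
have sn_ge1 : 1 <= Num.sqrt (n%:R : R).
  by rewrite -[X in X <= _]sqrtr1 ler_sqrt // (le_trans (ltW lam_gt1)).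
move: Ks sn_sq sn_ge1 sn_gt0; set s := Num.sqrt _ => Ks sn_sq sn_ge1 sn_gt0.
set k : R := (K n)%:R in Ks *; have k_ge0 : 0 <= k by exact: ler0n.
have kn : k <= eta * n%:R.
  by rewrite (le_trans Ks) // ler_wpM2l ?(ltW eta_gt0) // -sn_sq ler_eXnr.
have k2n : 2 * k * lam <= n%:R * (lam - 1) by nra.
have k_half : 2 * k <= n%:R.
  have : n%:R * (lam - 1) <= n%:R * lam by nra.
  by move=> h; rewrite -(ler_pM2r lam_gt0) (le_trans k2n).
have lt_Kn : (K n < n)%N by rewrite -(ltr_nat R) -/k; lra.
have nKE : (n - K n)%:R = n%:R - k :> R by rewrite natrB // ltnW.
apply: (@sum_dist_small _ _ _ (2 * k / n%:R) rho C) => //.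
- by rewrite divr_ge0 ?mulr_ge0 // ltW.
- exact: ltW.
- rewrite nKE mulrAC ler_pdivlMr // -/k; nra.
- rewrite nKE ler_pdivrMr // /rho.
  rewrite [leRHS](_ : _ = 2 * (n%:R - k) * lam / (1 + lam)); last by ring.
  by rewrite ler_pdivlMr ?addr_gt0 //; nra.
- by apply: geom_sum_lt1 => //; exact: ltW.
- rewrite -/k (le_trans _ eta_d) //.
  have k2 : k * k <= eta * n%:R.
    have : k * k <= eta * s * (eta * s) by apply: ler_pM.
    move/le_trans; apply; rewrite -sn_sq.
    have : eta <= 1 by nra.
    move=> e1; have -> : eta * s * (eta * s) = eta * (eta * s ^+ 2) by ring.
    by rewrite ler_wpM2l ?(ltW eta_gt0) // ger_pMl // sn_sq.
  have -> : k * (2 * k / n%:R * (2 * C)) = k * k * (4 * C) / n%:R by ring.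
  rewrite ler_pdivrMr // [leRHS]mulrAC; apply: ler_wpM2r => //.
  by rewrite mulr_ge0 // ltW.
Unshelve. all: by end_near.
Qed.

Lemma sum_dist_subcritical (K : nat -> nat) (eps : R) :
  lam < 1 ->
  (fun n : nat =>
     (ln (n%:R : R) / ln lam^-1 - (K n)%:R) / ln (ln (n%:R : R))) @ \oo --> +oo ->
  0 < eps ->
  \forall n \near \oo, \sum_(G : graph n) `|P0 lam G - P1 lam (K n) G| <= eps.
Proof.
move=> lam_lt1 K_small eps_gt0.
set d := ln (1 + eps ^+ 2).
have d_gt0 : 0 < d by rewrite ln_gt0 // ltrDl exprn_gt0.
set l := ln lam^-1 in K_small.
have l_gt0 : 0 < l by rewrite ln_gt0 // invf_gt1.
pose e : R := expR 1; have e_gt0 : 0 < e by exact: expR_gt0.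
(* Lower bounds for [L = ln n]: 2 makes [ln L] positive, the second entry yields [2 * K ^ 2 <= n],
   and the third beats the constant in the final estimate. *)
pose L0 := Num.max 2 (Num.max (2 / l ^+ 2) (8 * e / (l ^+ 3 * d))).
(* The constant [4 / l] buys [lam^-1 ^+ K * L ^+ 4 <= n]: three powers of [L] absorb [K ^ 3], and
   the fourth absorbs the constants. *)
have /cvgryPge/(_ (4 / l)) K_near := K_small.
near=> n.
have n_ge : expR L0 <= n%:R by near: n; exact: nbhs_infty_ger.
have n_gt0 : 0 < n%:R :> R by apply: lt_le_trans n_ge; exact: expR_gt0.
have K_le : 4 / l <= (ln n%:R / l - (K n)%:R) / ln (ln n%:R) by near: n.
set L := ln (n%:R : R).
have : L0 <= L by rewrite /L -[L0]expRK ler_ln ?posrE // expR_gt0.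
rewrite !ge_max => /and3P[L_ge2 L_l L_d].
have L_gt0 : 0 < L by lra.
have lnL_gt0 : 0 < ln L by rewrite ln_gt0 //; lra.
set k : R := (K n)%:R; have k_ge0 : 0 <= k by exact: ler0n.
have key : k * l + 4 * ln L <= L.
  move: K_le; rewrite -/L -/k.
  rewrite ler_pdivlMr // mulrAC ler_pdivrMr // mulrBl divfK ?gt_eqF //; lra.
have kL : k * l <= L by lra.
have expkey : lam^-1 ^+ K n * L ^+ 4 <= n%:R.
  rewrite -[leRHS]lnK ?posrE // -/L -[X in X * _]lnK; last first.
    by rewrite posrE exprn_gt0 // invr_gt0.
  rewrite -[L ^+ 4]lnK; last by rewrite posrE exprn_gt0.
  rewrite -expRD ler_expR !lnXn ?invr_gt0 // -/l -[l *+ _]mulr_natl.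
  by rewrite -[ln L *+ 4]mulr_natl.
set a := lam^-1 ^+ K n in expkey.
have ilam_ge1 : 1 <= lam^-1 by rewrite invf_ge1 // ltW.
have a_ge1 : 1 <= a by exact: exprn_ege1.
have L4 : L ^+ 4 <= n%:R.
  by apply: le_trans expkey; rewrite ler_peMl // exprn_ge0 // ltW.
have k2 : k ^+ 2 * 2 <= n%:R.
  apply: le_trans L4.
  have : k ^+ 2 * l ^+ 2 <= L ^+ 2.
    by rewrite -exprMn lerXn2r ?nnegrE ?mulr_ge0 // ltW.
  move: L_l; rewrite ler_pdivrMr ?exprn_gt0 // => L_l.
  have L_L2 : L <= L ^+ 2 by rewrite ler_eXnr //; lra.
  have l2_gt0 : 0 < l ^+ 2 by rewrite exprn_gt0.
  have k2_ge0 : 0 <= k ^+ 2 by rewrite sqr_ge0.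
  move=> h; rewrite -(ler_pM2r l2_gt0).
  have -> : L ^+ 4 * l ^+ 2 = L ^+ 2 * (L ^+ 2 * l ^+ 2) by ring.
  rewrite mulrAC; apply: ler_pM => //; first by rewrite mulr_ge0 // ltW.
  by rewrite (le_trans L_l) // ler_wpM2r // ltW.
have k_sq : k <= k ^+ 2.
  by rewrite /k -natrX ler_nat; case: (K n) => // m; rewrite leq_pmulr.
have k_half : 2 * k <= n%:R by lra.
have lt_Kn : (K n < n)%N by rewrite -(ltr_nat R) -/k; lra.
have nKE : (n - K n)%:R = n%:R - k :> R by rewrite natrB // ltnW.
have nk_gt0 : 0 < n%:R - k by lra.
(* Here [rho] is exactly [y / (n - K)] with [y = n / lam]. The correction [r ^+ K] is at most
   [expR (K ^ 2 / (n - K))], hence at most [e], because [K + K ^ 2 <= n]. *)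
pose r : R := n%:R / (n%:R - k); pose rho := lam^-1 * r.
have r_ge1 : 1 <= r by rewrite ler_pdivlMr // mul1r lerBlDr lerDl.
have rho_ge1 : 1 <= rho by rewrite mulr_ege1.
have rk : r ^+ K n <= e.
  have -> : r = 1 + k / (n%:R - k) by rewrite /r; field; rewrite gt_eqF.
  apply: (@le_trans _ _ (expR (k / (n%:R - k)) ^+ K n)).
    by rewrite lerXn2r ?nnegrE ?expR_ge0 ?expR_ge1Dx // addr_ge0 // divr_ge0 // ltW.
  rewrite -expRM_natl ler_expR -/k mulrA ler_pdivrMr // mul1r -expr2; lra.
apply: (@sum_dist_small _ _ _ (2 * k / n%:R) rho ((K n).+1%:R * (a * e))) => //.
- by apply: le_trans (ltW lam_lt1) _; rewrite ler1n -(ltr0n R).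
- by rewrite divr_ge0 ?mulr_ge0 // ltW.
- exact: le_trans rho_ge1.
- rewrite nKE mulrAC ler_pdivlMr // -/k; nra.
- by rewrite nKE /rho /r -mulrA divfK ?gt_eqF // mulrC.
- apply: le_trans (geom_sum_ge1_le _ rho_ge1) _.
  rewrite ler_wpM2l // exprMn ler_wpM2l // (le_trans ler01) //.
(* The exponent is at most [8 * e * K ^ 3 * a / n]. Then [8 * e <= L * l ^ 3 * d] and
   [(K * l) ^ 3 <= L ^ 3] bound it by [d * a * L ^ 4 / n <= d]. *)
- have kS : k * (K n).+1%:R <= 2 * k ^+ 2 by rewrite -natr1 -/k; nra.
  have L_d' : 8 * e <= L * (l ^+ 3 * d).
    by rewrite -ler_pdivrMr // mulr_gt0 // exprn_gt0.
  have k3 : k ^+ 3 * l ^+ 3 <= L ^+ 3.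
    by rewrite -exprMn lerXn2r ?nnegrE ?mulr_ge0 // ltW.
  rewrite -/k.
  have -> : k * (2 * k / n%:R * (2 * ((K n).+1%:R * (a * e)))) =
     4 * k * (k * (K n).+1%:R) * (a * e) / n%:R by ring.
  rewrite ler_pdivrMr //.
  apply: (@le_trans _ _ (k ^+ 3 * a * (8 * e))).
    have -> : k ^+ 3 * a * (8 * e) = 4 * k * (2 * k ^+ 2) * (a * e) by ring.
    apply: ler_wpM2r; first by rewrite mulr_ge0 // ltW // (lt_le_trans ltr01).
    by apply: ler_wpM2l => //; rewrite mulr_ge0.
  apply: (@le_trans _ _ (k ^+ 3 * a * (L * (l ^+ 3 * d)))).
    by apply: ler_wpM2l => //; rewrite mulr_ge0 ?exprn_ge0 // (le_trans ler01).
  have -> : k ^+ 3 * a * (L * (l ^+ 3 * d)) = d * (a * L * (k ^+ 3 * l ^+ 3)) by ring.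
  apply: ler_wpM2l; first exact: ltW.
  apply: le_trans expkey.
  have -> : a * L ^+ 4 = a * L * L ^+ 3 by ring.
  by apply: ler_wpM2l => //; rewrite mulr_ge0 ?(ltW L_gt0) // (le_trans ler01).
Unshelve. all: by end_near.
Qed.

End Asymptotics.

(** * From the L1 distance to total variation and tests *)

Lemma prob_test_dist (R : realType) n (P Q : graph n -> R) (T : graph n -> bool) :
  `|prob_test Q T - prob_test P T| <= \sum_(G : graph n) `|P G - Q G|.
Proof.
rewrite /prob_test -sumrB (le_trans (ler_norm_sum _ _ _)) //.
apply: ler_sum => G _; rewrite -mulrBl normrM distrC ler_piMr //.
by case: (T G); rewrite ?normr1 ?normr0.
Qed.

Theorem theorem6 (R : realType) (lam : R) (K : nat -> nat) :
  0 < lam ->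
  ((1 < lam /\
      (fun n : nat => (K n)%:R / Num.sqrt (n%:R : R)) @ \oo --> (0 : R))
   \/
   (lam < 1 /\
      (fun n : nat =>
         (ln (n%:R : R) / ln lam^-1 - (K n)%:R) / ln (ln (n%:R : R)))
        @ \oo --> +oo)) ->
  (fun n : nat => TV lam n (K n)) @ \oo --> (0 : R)
  /\
  (forall T : forall n : nat, graph n -> bool,
     (fun n : nat => prob_test (P1 lam (K n)) (T n)
                     - prob_test (P0 lam (n:=n)) (T n)) @ \oo --> (0 : R)).
Proof.
move=> lam_gt0 regime.
have dist_small (eps : R) : 0 < eps ->
    \forall n \near \oo, \sum_(G : graph n) `|P0 lam G - P1 lam (K n) G| <= eps.
  by case: regime => -[? ?]; [exact: sum_dist_supercritical|exact: sum_dist_subcritical].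
split=> [|T]; apply/cvgr0Pnorm_le => eps eps_gt0; near=> n.
  have le_eps : \sum_(G : graph n) `|P0 lam G - P1 lam (K n) G| <= eps.
    by near: n; exact: dist_small.
  have ge0 : 0 <= \sum_(G : graph n) `|P0 lam G - P1 lam (K n) G| by exact: sumr_ge0.
  rewrite /TV ger0_norm ?mulr_ge0 ?invr_ge0 //; lra.
apply: le_trans (prob_test_dist _ _ _) _.
by near: n; exact: dist_small.
Unshelve. all: by end_near.
Qed.
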